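(* Suppose that $\mu(\tau)\neq0$. (a) If $\tau$ satisfies exponential large deviation bounds and $f$ and $G$ are exponentially mixing, then $F$ is exponentially mixing. (b) If $\tau$ satisfies polynomial large deviation bounds and $f$ and $G$ are polynomially mixing, then $F$ is polynomially mixing. (c) If $\tau$ satisfies superpolynomial large deviation bounds and $f$ and $G$ are rapidly mixing, then $F$ is rapidly mixing.
   Context: Setting. $X,Y$ are compact manifolds, $f:X\to X$ is a smooth map preserving a probability measure $\mu$, $(G_t)_{t\in\mathbb R^d}$ is a smooth $d$-parameter flow ($\mathbb R^d$-action) on $Y$ preserving a probability measure $\nu$, and $\tau:X\to\mathbb R^d$ is smooth. Put $\tau_N(x)=\sum_{n=0}^{N-1}\tau(f^nx)$, $\zeta=\mu\times\nu$, and $F(x,y)=(f(x),G_{\tau(x)}y)$ on $X\times Y$, so $F$ preserves $\zeta$. Write $\mu(A)=\int A\,d\mu$, etc. Mixing rates. $G$ is mixing with rate $\psi(t)$ on a space $\mathbb B$ if there is $C$ such that $\left|\int B_1(y)B_2(G_ty)\,d\nu(y)-\nu(B_1)\nu(B_2)\right|\le C\psi(t)\|B_1\|_{\mathbb B}\|B_2\|_{\mathbb B}$ for all $B_1,B_2\in\mathbb B$ and all $t$. $G$ is exponentially mixing if this holds with $\mathbb B=C^r$ for some $r>0$ and $\psi(t)=e^{-\delta\|t\|}$ for some $\delta>0$; polynomially mixing if it holds with $\mathbb B=C^r$ for some $r>0$ and $\psi(t)=\|t\|^{-\delta}$ for some $\delta>0$; rapidly mixing if for each $m$ there exists $r$ such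 that it holds with $\mathbb B=C^r$ and $\psi(t)=\|t\|^{-m}$. The same definitions apply to maps (such as $f$ with measure $\mu$ and $F$ with measure $\zeta$), with $t$ replaced by $n\in\mathbb N$ and $G_t$ by the $n$-th iterate. Large deviations. $\tau$ satisfies exponential (respectively polynomial) large deviation bounds if for each $\varepsilon>0$ there exist $C$ and $\delta>0$ such that for any $N\in\mathbb N$, $\mu\left(\left\|\tau_N/N-\mu(\tau)\right\|\ge\varepsilon\right)\le Ce^{-\delta N}$ (respectively $\le CN^{-\delta}$). It satisfies superpolynomial large deviation bounds if for each $w>0$, $\varepsilon>0$ there exists $C=C(\varepsilon,w)$ such that for any $N\in\mathbb N$ this measure is $\le CN^{-w}$. *)

(* Defs.v *)
From HB Require Import structures.
From mathcomp Require Import all_boot all_order all_algebra.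
From mathcomp Require Import all_classical all_reals all_analysis.
Set Implicit Arguments.
Unset Strict Implicit.
Unset Printing Implicit Defensive.
Import Order.TTheory GRing.Theory Num.Theory.
Import numFieldNormedType.Exports.
Local Open Scope classical_set_scope.
Local Open Scope ring_scope.

Definition partials (R : realType) (n : nat) (s : seq 'I_n)
    (h : 'rV[R]_n -> R) : 'rV[R]_n -> R :=
  foldr (fun i g => 'D_(delta_mx 0 i) g) h s.

(* Intended for open U.  'D_v is a total operator, hence the explicit
   requirement that the partial derivatives exist. *)
Definition Ck_on (R : realType) (n : nat) (U : set 'rV[R]_n) (k : nat)
    (h : 'rV[R]_n -> R) : Prop :=
  forall s : seq 'I_n, (size s <= k)%N ->
    (forall z, U z -> {for z, continuous (partials s h)}) /\
    ((size s < k)%N ->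
      forall z, U z -> forall i, derivable (partials s h) z (delta_mx 0 i)).

Definition smooth_on (R : realType) (n p : nat) (U : set 'rV[R]_n)
    (g : 'rV[R]_n -> 'rV[R]_p) : Prop :=
  forall (k : nat) (j : 'I_p), Ck_on U k (fun z => g z 0 j).

(* [chart i] and [chart_inv i] are total functions; only their values on
   [chart_dom i] and on [chart_img A i] are meaningful. *)
Record atlas (R : realType) (T : Type) (n : nat) := Atlas {
  chart_idx : Type;
  chart_dom : chart_idx -> set T;
  chart : chart_idx -> T -> 'rV[R]_n;
  chart_inv : chart_idx -> 'rV[R]_n -> T }.

Definition chart_img (R : realType) (T : Type) (n : nat) (A : atlas R T n)
  (i : chart_idx A) : set 'rV[R]_n := chart i @` chart_dom i.
Arguments chart_img {R T n} A i.

Record smooth_atlas (R : realType) (T : topologicalType) (n : nat)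
    (A : atlas R T n) : Prop := SmoothAtlas {
  atlas_cover : forall x, exists i : chart_idx A, chart_dom i x;
  atlas_dom_open : forall i : chart_idx A, open (chart_dom i);
  atlas_img_open : forall i : chart_idx A, open (chart_img A i);
  atlas_chartK : forall (i : chart_idx A) x,
    chart_dom i x -> chart_inv i (chart i x) = x;
  atlas_chart_cont : forall (i : chart_idx A) x,
    chart_dom i x -> {for x, continuous (chart i)};
  atlas_inv_cont : forall (i : chart_idx A) z,
    chart_img A i z -> {for z, continuous (chart_inv i)};
  atlas_transition : forall i j : chart_idx A,
    smooth_on (chart i @` (chart_dom i `&` chart_dom j))
      (chart j \o chart_inv i) }.

(* A finite family of charts with compact pieces of their domains that
   together cover the manifold; it serves to define the C^r norms.  Different
   covers give equivalent norms. *)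
Record core_cover (R : realType) (T : Type) (n : nat) (A : atlas R T n) :=
  CoreCover {
    core_idx : finType;
    core_chart : core_idx -> chart_idx A;
    core : core_idx -> set T }.

Record good_cover (R : realType) (T : topologicalType) (n : nat)
    (A : atlas R T n) (K : core_cover A) : Prop := GoodCover {
  core_compact : forall c : core_idx K, compact (core c);
  core_sub : forall c : core_idx K, core c `<=` chart_dom (core_chart c);
  core_covers : forall x, exists c : core_idx K, core c x }.

(* The base point is required by the measurable structures of the library;
   a space carrying a probability measure is not empty. *)
Record compactManifold (R : realType) := CompactManifold {
  cm_sort :> ptopologicalType;
  cm_dim : nat;
  cm_atlas : atlas R cm_sort cm_dim;
  cm_cover : core_cover cm_atlas;
  cm_hausdorff : hausdorff_space cm_sort;
  cm_compact : compact [set: cm_sort];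
  cm_smooth : smooth_atlas cm_atlas;
  cm_good : good_cover cm_cover }.

Definition smooth_map (R : realType) (T S : topologicalType) (n p : nat)
    (A : atlas R T n) (B : atlas R S p) (g : T -> S) : Prop :=
  continuous g /\
  forall (i : chart_idx A) (j : chart_idx B),
    smooth_on (chart i @` (chart_dom i `&` g @^-1` chart_dom j))
      (chart j \o g \o chart_inv i).

Definition euclidean_atlas (R : realType) (n : nat) : atlas R 'rV[R]_n n :=
  Atlas (fun _ : unit => setT) (fun _ => id) (fun _ => id).

Definition prod_atlas (R : realType) (T S : Type) (n p : nat)
    (A : atlas R T n) (B : atlas R S p) : atlas R (T * S)%type (n + p) :=
  @Atlas R (T * S)%type (n + p) (chart_idx A * chart_idx B)%type
    (fun ij => chart_dom ij.1 `*` chart_dom ij.2)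
    (fun ij xy => row_mx (chart ij.1 xy.1) (chart ij.2 xy.2))
    (fun ij z => (chart_inv ij.1 (lsubmx z), chart_inv ij.2 (rsubmx z))).

Definition prod_cover (R : realType) (T S : Type) (n p : nat)
    (A : atlas R T n) (B : atlas R S p) (K : core_cover A) (L : core_cover B) :
    core_cover (prod_atlas A B) :=
  @CoreCover R (T * S)%type (n + p) (prod_atlas A B)
    (core_idx K * core_idx L)%type
    (fun cd => (core_chart cd.1, core_chart cd.2))
    (fun cd => core cd.1 `*` core cd.2).

(* Completes the library's instances: a product of pointed topological spaces
   is a pointed topological space. *)
HB.instance Definition _ (T S : ptopologicalType) :=
  Pointed.on (T * S)%type.

Section prod_manifold.
Variable R : realType.

Lemma lsubmx_cont (n p : nat) :
  continuous (lsubmx : 'rV[R]_(n + p) -> 'rV[R]_n).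
Proof.
move=> z U /= /nbhs_ballP[e /= e0 eU]; apply/nbhs_ballP; exists e => //= w zw.
apply: eU; case: zw => _ zw; split=> // i j; rewrite !mxE; exact: zw.
Qed.

Lemma rsubmx_cont (n p : nat) :
  continuous (rsubmx : 'rV[R]_(n + p) -> 'rV[R]_p).
Proof.
move=> z U /= /nbhs_ballP[e /= e0 eU]; apply/nbhs_ballP; exists e => //= w zw.
apply: eU; case: zw => _ zw; split=> // i j; rewrite !mxE; exact: zw.
Qed.

Lemma row_mx_cont (T : topologicalType) (n p : nat) (f : T -> 'rV[R]_n)
    (g : T -> 'rV[R]_p) x :
  {for x, continuous f} -> {for x, continuous g} ->
  {for x, continuous (fun x => row_mx (f x) (g x))}.
Proof.
move=> fx gx U /= /nbhs_ballP[e /= e0 eU].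
have nf : nbhs x (fun y => ball (f x) e (f y)).
  by apply: fx; exact: nbhsx_ballx.
have ng : nbhs x (fun y => ball (g x) e (g y)).
  by apply: gx; exact: nbhsx_ballx.
apply: (filterS _ (filterI nf ng)) => y /= [[_ fy] [_ gy]].
apply: eU; split=> // i j; rewrite !mxE.
by case: (fintype.split j) => l; [exact: fy|exact: gy].
Qed.

Lemma derive_along0 (n : nat) (h : 'rV[R]_n -> R) z :
  derivable h z 0 /\ 'D_0 h z = 0.
Proof.
have E : (fun t : R => t^-1 *: ((h \o shift z) (t *: 0) - h z)) = cst 0.
  by apply/funext => t /=; rewrite scaler0 add0r subrr scaler0.
rewrite /derivable /derive E; split; first exact: is_cvg_cst.
exact: lim_cst.
Qed.

Lemma derive_comp_linear (n q : nat) (L : {linear 'rV[R]_q -> 'rV[R]_n})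
    (h : 'rV[R]_n -> R) z v :
  (derivable h (L z) (L v) -> derivable (h \o L) z v) /\
  'D_v (h \o L) z = 'D_(L v) h (L z).
Proof.
have E : (fun t : R => t^-1 *: (((h \o L) \o shift z) (t *: v) - (h \o L) z))
    = (fun t : R => t^-1 *: ((h \o shift (L z)) (t *: L v) - h (L z))).
  apply/funext => t /=.
  by have -> : L (t *: v + z) = t *: L v + L z by exact: linearP.
by rewrite /derivable /derive E.
Qed.

Section coordinate_projection.
Variables (n q : nat) (L : {linear 'rV[R]_q -> 'rV[R]_n}).
Hypothesis L_cont : continuous L.
Hypothesis L_delta : forall i : 'I_q,
  L (delta_mx 0 i) = 0 \/ exists j, L (delta_mx 0 i) = delta_mx 0 j.

Lemma partials_comp (h : 'rV[R]_n -> R) (s : seq 'I_q) :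
  (exists2 s', size s' = size s & partials s (h \o L) = partials s' h \o L) \/
  partials s (h \o L) = cst 0.
Proof.
elim: s => [|i s IH]; first by left; exists [::].
case: IH => [[s' ss' E]|E]; last first.
  right; rewrite /= E; apply/funext => z; exact: derive_cst.
case: (L_delta i) => [Li|[j Li]].
  right; rewrite /= E; apply/funext => z.
  by rewrite (derive_comp_linear L _ z _).2 Li (derive_along0 _ _).2.
left; exists (j :: s'); first by rewrite /= ss'.
by rewrite /= E; apply/funext => z; rewrite (derive_comp_linear L _ z _).2 Li.
Qed.

Lemma Ck_on_comp (U : set 'rV[R]_n) k (h : 'rV[R]_n -> R) :
  Ck_on U k h -> Ck_on (L @^-1` U) k (h \o L).
Proof.
move=> hC s sk; case: (partials_comp h s) => [[s' ss' ->]|->]; last first.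
  split=> [z _|_ z _ i]; first exact: cst_continuous.
  exact: derivable_cst.
rewrite -ss' in sk *; have [hc hd] := hC _ sk; split=> [z Uz|ss z Uz i].
  by apply: continuous_comp; [exact: L_cont|exact: hc].
apply: (derive_comp_linear L _ z _).1.
case: (L_delta i) => [->|[j ->]]; last exact: hd.
exact: (derive_along0 _ _).1.
Qed.

End coordinate_projection.

Lemma Ck_on_sub (n : nat) (U V : set 'rV[R]_n) k (h : 'rV[R]_n -> R) :
  U `<=` V -> Ck_on V k h -> Ck_on U k h.
Proof.
move=> UV hV s sk; have [hc hd] := hV s sk.
by split=> [z /UV|ss z /UV Vz i]; [exact: hc|exact: hd].
Qed.

Lemma lsubmx_delta (n p : nat) (i : 'I_(n + p)) :
  lsubmx (delta_mx 0 i : 'rV[R]_(n + p)) = 0 \/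
  exists j, lsubmx (delta_mx 0 i : 'rV[R]_(n + p)) = delta_mx 0 j.
Proof.
case: (split_ordP i) => j ->; [right; exists j|left];
  apply/rowP => l; rewrite !mxE ?eq_lshift ?eq_lrshift //.
Qed.

Lemma rsubmx_delta (n p : nat) (i : 'I_(n + p)) :
  rsubmx (delta_mx 0 i : 'rV[R]_(n + p)) = 0 \/
  exists j, rsubmx (delta_mx 0 i : 'rV[R]_(n + p)) = delta_mx 0 j.
Proof.
case: (split_ordP i) => j ->; [left|right; exists j];
  apply/rowP => l; rewrite !mxE ?eq_rshift ?eq_rlshift //.
Qed.

Section atlas_product.
Variables (T S : topologicalType) (n p : nat).
Variables (A : atlas R T n) (B : atlas R S p).

Lemma prod_chart_img (i : chart_idx A) (j : chart_idx B)
    (U : set T) (V : set S) :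
  (fun xy : T * S => row_mx (chart i xy.1) (chart j xy.2)) @` (U `*` V) =
  (lsubmx @^-1` (chart i @` U)) `&` (rsubmx @^-1` (chart j @` V)).
Proof.
apply/seteqP; split=> [_ [[x y] /= [Ux Vy] <-]|z /= [[x Ux xz] [y Vy yz]]].
  by rewrite row_mxKl row_mxKr; split; [exists x|exists y].
by exists (x, y) => //=; rewrite xz yz hsubmxK.
Qed.

Lemma smooth_prod_atlas :
  smooth_atlas A -> smooth_atlas B -> smooth_atlas (prod_atlas A B).
Proof.
move=> sA sB; split.
- move=> [x y]; have [i xi] := atlas_cover sA x.
  by have [j yj] := atlas_cover sB y; exists (i, j).
- move=> [i j] /=; have oi := atlas_dom_open sA i.
  have oj := atlas_dom_open sB j.
  rewrite openE => -[x y] /= [xi yj]; exists (chart_dom i, chart_dom j) => //=.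
  by split; exact: open_nbhs_nbhs.
- move=> [i j]; rewrite [chart_img _ _](prod_chart_img i j); apply: openI.
    by apply: open_comp; [move=> ? _; exact: lsubmx_cont|
                          exact: atlas_img_open sA i].
  by apply: open_comp; [move=> ? _; exact: rsubmx_cont|
                        exact: atlas_img_open sB j].
- move=> [i j] [x y] /= [xi yj].
  by rewrite row_mxKl row_mxKr (atlas_chartK sA) ?(atlas_chartK sB).
- move=> [i j] [x y] /= [xi yj]; apply: row_mx_cont.
    apply: (@continuous_comp _ _ _ fst (chart i)); first exact: cvg_fst.
    exact: atlas_chart_cont sA _ _ xi.
  apply: (@continuous_comp _ _ _ snd (chart j)); first exact: cvg_snd.
  exact: atlas_chart_cont sB _ _ yj.
- move=> [i j] z; rewrite [chart_img _ _](prod_chart_img i j) => -[zi zj].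
  have ci : {for z, continuous (chart_inv i \o lsubmx)}.
    apply: continuous_comp; first exact: lsubmx_cont.
    exact: atlas_inv_cont sA _ _ zi.
  have cj : {for z, continuous (chart_inv j \o rsubmx)}.
    apply: continuous_comp; first exact: rsubmx_cont.
    exact: atlas_inv_cont sB _ _ zj.
  exact: cvg_pair ci cj.
- move=> [i j] [i' j'] k l /=; rewrite -setXI (prod_chart_img i j).
  case: (split_ordP l) => m ->.
  + apply: (@Ck_on_sub _ _ (lsubmx @^-1`
      (chart i @` (chart_dom i `&` chart_dom i')))); first by move=> z [].
    rewrite (_ : (fun z => _) =
      (fun z => (chart i' \o chart_inv i) z 0 m) \o lsubmx); last first.
      by apply/funext => z /=; rewrite row_mxEl.
    apply: Ck_on_comp; [exact: lsubmx_cont|exact: lsubmx_delta|].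
    exact: atlas_transition.
  + apply: (@Ck_on_sub _ _ (rsubmx @^-1`
      (chart j @` (chart_dom j `&` chart_dom j')))); first by move=> z [].
    rewrite (_ : (fun z => _) =
      (fun z => (chart j' \o chart_inv j) z 0 m) \o rsubmx); last first.
      by apply/funext => z /=; rewrite row_mxEr.
    apply: Ck_on_comp; [exact: rsubmx_cont|exact: rsubmx_delta|].
    exact: atlas_transition.
Qed.

Lemma good_prod_cover (K : core_cover A) (L : core_cover B) :
  good_cover K -> good_cover L -> good_cover (prod_cover K L).
Proof.
move=> gK gL; split.
- by move=> [c d]; apply: compact_setX;
    [exact: core_compact gK c|exact: core_compact gL d].
- move=> [c d] [x y] /= [xc yd].
  by split; [exact: core_sub gK _ _ xc|exact: core_sub gL _ _ yd].
- move=> [x y]; have [c xc] := core_covers gK x.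
  by have [d yd] := core_covers gL y; exists (c, d).
Qed.

Lemma hausdorff_prod :
  hausdorff_space T -> hausdorff_space S -> hausdorff_space (T * S)%type.
Proof.
move=> hT hS [x y] [x' y'] cl; congr pair.
  apply: hT => U V Ux Vx'.
  have [] := cl (fst @^-1` U) (fst @^-1` V).
  - exact: (@cvg_fst _ _ (nbhs x) (nbhs y)).
  - exact: (@cvg_fst _ _ (nbhs x') (nbhs y')).
  by move=> z [zU zV]; exists z.1.
apply: hS => U V Uy Vy'.
have [] := cl (snd @^-1` U) (snd @^-1` V).
- exact: (@cvg_snd _ _ (nbhs x) (nbhs y)).
- exact: (@cvg_snd _ _ (nbhs x') (nbhs y')).
by move=> z [zU zV]; exists z.2.
Qed.

End atlas_product.

Lemma compact_prod (T S : topologicalType) :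
  compact [set: T] -> compact [set: S] -> compact [set: (T * S)%type].
Proof. by move=> cT cS; rewrite -setXTT; exact: compact_setX. Qed.

Definition prod_manifold (X Y : compactManifold R) : compactManifold R :=
  @CompactManifold R (X * Y)%type (cm_dim X + cm_dim Y)
    (prod_atlas (cm_atlas X) (cm_atlas Y))
    (prod_cover (cm_cover X) (cm_cover Y))
    (hausdorff_prod (@cm_hausdorff _ X) (@cm_hausdorff _ Y))
    (compact_prod (@cm_compact _ X) (@cm_compact _ Y))
    (smooth_prod_atlas (cm_smooth X) (cm_smooth Y))
    (good_prod_cover (cm_good X) (cm_good Y)).

End prod_manifold.

Definition Cr (R : realType) (M : compactManifold R) (r : nat)
    (B : M -> R) : Prop :=
  forall i : chart_idx (cm_atlas M),
    Ck_on (chart_img (cm_atlas M) i) r (B \o chart_inv i).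

Definition Cr_norm (R : realType) (M : compactManifold R) (r : nat)
    (B : M -> R) : R :=
  sup [set a | exists (c : core_idx (cm_cover M)) (s : seq 'I_(cm_dim M))
                      (x : M),
    [/\ (size s <= r)%N, core c x &
        a = `|partials s (B \o chart_inv (core_chart c))
                (chart (core_chart c) x)| ]].

Notation borel T := (g_sigma_algebraType (@open T)).

Definition preserves (R : realType) (d : measure_display)
    (S : measurableType d) (m : {measure set S -> \bar R}) (g : S -> S) : Prop :=
  forall E : set S, measurable E -> m (g @^-1` E) = m E.

Definition corr (R : realType) (d : measure_display) (S : measurableType d)
    (m : {measure set S -> \bar R}) (g : S -> S) (B1 B2 : S -> R) : R :=
  \int[m]_z (B1 z * B2 (g z)) - (\int[m]_z B1 z) * (\int[m]_z B2 z).

(* The observables are given by a membership predicate and a norm, not by a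
   manifold, because the sigma-algebra on X * Y is the product one, not
   syntactically the Borel one. *)
Definition mixing_with_rate (R : realType) (d : measure_display)
    (S : measurableType d) (m : {measure set S -> \bar R})
    (obs : (S -> R) -> Prop) (nrm : (S -> R) -> R)
    (I : Type) (phi : I -> S -> S) (D : set I) (psi : I -> R) : Prop :=
  exists C : R, forall B1 B2, obs B1 -> obs B2 -> forall t, D t ->
    `|corr m (phi t) B1 B2| <= C * psi t * nrm B1 * nrm B2.

Section rates.
Variables (R : realType) (d : measure_display) (S : measurableType d).
Variable (m : {measure set S -> \bar R}).
Variables (obs : nat -> (S -> R) -> Prop) (nrm : nat -> (S -> R) -> R).
Variables (I : Type) (len : I -> R) (phi : I -> S -> S).

Definition exp_mixing : Prop :=
  exists (r : nat) (delta : R), [/\ (0 < r)%N, 0 < delta &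
    mixing_with_rate m (obs r) (nrm r) phi setT
      (fun t => expR (- delta * len t))].

(* Time 0, where a negative power is infinite, is left out: in the library
   0 `^ (- delta) = 0, and 0 ^- k = 0 for k > 0. *)
Definition poly_mixing : Prop :=
  exists (r : nat) (delta : R), [/\ (0 < r)%N, 0 < delta &
    mixing_with_rate m (obs r) (nrm r) phi [set t | 0 < len t]
      (fun t => len t `^ (- delta))].

Definition rapid_mixing : Prop :=
  forall k : nat, exists r : nat, (0 < r)%N /\
    mixing_with_rate m (obs r) (nrm r) phi [set t | 0 < len t]
      (fun t => len t ^- k).

End rates.

Section actions.
Variables (R : realType) (d : measure_display) (S : measurableType d).
Variable (m : {measure set S -> \bar R}).
Variables (obs : nat -> (S -> R) -> Prop) (nrm : nat -> (S -> R) -> R).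

Definition map_exp_mixing (g : S -> S) : Prop :=
  exp_mixing m obs nrm (fun n : nat => n%:R) (fun n => iter n g).
Definition map_poly_mixing (g : S -> S) : Prop :=
  poly_mixing m obs nrm (fun n : nat => n%:R) (fun n => iter n g).
Definition map_rapid_mixing (g : S -> S) : Prop :=
  rapid_mixing m obs nrm (fun n : nat => n%:R) (fun n => iter n g).

Definition flow_exp_mixing (k : nat) (G : 'rV[R]_k -> S -> S) : Prop :=
  exp_mixing m obs nrm (fun t => `|t|) G.
Definition flow_poly_mixing (k : nat) (G : 'rV[R]_k -> S -> S) : Prop :=
  poly_mixing m obs nrm (fun t => `|t|) G.
Definition flow_rapid_mixing (k : nat) (G : 'rV[R]_k -> S -> S) : Prop :=
  rapid_mixing m obs nrm (fun t => `|t|) G.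

End actions.

Record smooth_flow (R : realType) (k : nat) (Y : compactManifold R)
    (G : 'rV[R]_k -> Y -> Y) : Prop := SmoothFlow {
  flow0 : forall y, G 0 y = y;
  flowD : forall s t y, G (s + t) y = G s (G t y);
  flow_smooth : smooth_map (prod_atlas (euclidean_atlas R k) (cm_atlas Y))
    (cm_atlas Y) (fun ty : 'rV[R]_k * Y => G ty.1 ty.2) }.

Section large_deviations.
Variables (R : realType) (d : measure_display) (S : measurableType d).
Variables (m : {measure set S -> \bar R}) (f : S -> S).
Variables (k : nat) (tau : S -> 'rV[R]_k).

Definition birkhoff_sum (N : nat) (x : S) : 'rV[R]_k :=
  \sum_(0 <= n < N) tau (iter n f x).

Definition mean : 'rV[R]_k := \row_i \int[m]_x tau x 0 i.

Definition deviation_set (N : nat) (eps : R) : set S :=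
  [set x | eps <= `|N%:R^-1 *: birkhoff_sum N x - mean|].

Definition exp_large_deviations : Prop :=
  forall eps, 0 < eps -> exists C delta : R, 0 < delta /\
    forall N : nat, (0 < N)%N ->
      (m (deviation_set N eps) <= (C * expR (- delta * N%:R))%:E)%E.

Definition poly_large_deviations : Prop :=
  forall eps, 0 < eps -> exists C delta : R, 0 < delta /\
    forall N : nat, (0 < N)%N ->
      (m (deviation_set N eps) <= (C * N%:R `^ (- delta))%:E)%E.

Definition superpoly_large_deviations : Prop :=
  forall w eps, 0 < w -> 0 < eps -> exists C : R,
    forall N : nat, (0 < N)%N ->
      (m (deviation_set N eps) <= (C * N%:R `^ (- w))%:E)%E.

End large_deviations.

Definition skew_product (R : realType) (T S : Type) (k : nat) (f : T -> T)
    (G : 'rV[R]_k -> S -> S) (tau : T -> 'rV[R]_k) (xy : T * S) : T * S :=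
  (f xy.1, G (tau xy.1) xy.2).

(* Main.v *)
(* Write [F^N (x, y) = (f^N x, G_(tau_N x) y)].  By Fubini the correlation of A
   and B under F^N is the mu-integral over x of the nu-correlation of the
   sections A(x, .) and B(f^N x, .) under G_(tau_N x), plus the mu-correlation
   under f^N of the fiber averages of A and B.  The second term decays because f
   mixes and fiber averages of C^r functions are C^r.  In the first, outside the
   set where tau_N / N is at distance at least |mu(tau)| / 2 from mu(tau) one has
   |tau_N x| >= N |mu(tau)| / 2, so that mixing of G applies; the exceptional set
   is small by the large deviation bound. *)
Require Import Defs.
From HB Require Import structures.
From mathcomp Require Import all_boot all_order all_algebra.
From mathcomp Require Import all_classical all_reals all_analysis.
From mathcomp Require Import measurable_realfun.
From mathcomp Require Import ring.
Import Order.TTheory GRing.Theory Num.Theory.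
Import numFieldNormedType.Exports.
Local Open Scope classical_set_scope.
Local Open Scope ring_scope.
Set Implicit Arguments.
Unset Strict Implicit.

(** * Countable bases and measurability on the product *)

Section second_countability.
Variable R : realType.

(** Take a radius [1/(k+1)] below [e / 2] and a rational center that close to [z]: by the triangle
    inequality the ball stays within [e] of [z]. *)
Lemma nbhs_rational_ball (n : nat) (z : 'rV[R]_n) (U : set 'rV[R]_n) :
  nbhs z U -> exists (q : 'rV[rat]_n) (k : nat),
    ball (map_mx (@ratr R) q) k.+1%:R^-1 z /\
    ball (map_mx (@ratr R) q) k.+1%:R^-1 `<=` U.
Proof.
move=> /nbhs_ballP[e /= e0 eU].
have [k ke] : exists k : nat, (k.+1%:R^-1 : R) < e / 2.
  exists (Num.truncn (e / 2)^-1); rewrite invf_plt ?posrE ?divr_gt0//.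
  by rewrite truncnS_gt.
have k0 : 0 < k.+1%:R^-1 :> R by rewrite invr_gt0.
have q_ex (i : 'I_n) : exists q : rat, `|z 0 i - ratr q| < k.+1%:R^-1.
  have /rat_in_itvoo[q] : z 0 i - k.+1%:R^-1 < z 0 i + k.+1%:R^-1.
    by rewrite ltrD2l gt0_cp.
  by rewrite in_itv/= => qz; exists q; rewrite distrC ltr_distl.
have [q qz] := choice q_ex; exists (\row_i q i), k.
have bz : ball (map_mx (@ratr R) (\row_i q i)) k.+1%:R^-1 z.
  by split=> // i j; rewrite !mxE ord1 /ball/= distrC.
split=> // w qw; apply: eU; rewrite (splitr e).
apply: (@le_ball _ _ _ (k.+1%:R^-1 + k.+1%:R^-1)).
  by rewrite lerD// ltW.
exact: ball_triangle (ball_sym bz) qw.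
Qed.

Variable M : compactManifold R.

(** The index runs over the finite cover and not over the atlas, which may be uncountable; so these
    sets are countably many. *)
Definition chart_ball (i : core_idx (cm_cover M) * 'rV[rat]_(cm_dim M) * nat) :
    set M :=
  chart_dom (core_chart i.1.1) `&`
  chart (core_chart i.1.1) @^-1` ball (map_mx (@ratr R) i.1.2) i.2.+1%:R^-1.

Lemma chart_ball_open i : open (chart_ball i).
Proof.
rewrite openE => x [xi bx]; apply: filterI.
  by apply: open_nbhs_nbhs; split=> //; exact: atlas_dom_open (cm_smooth M) _.
apply: (atlas_chart_cont (cm_smooth M) xi).
by apply: open_nbhs_nbhs; split=> //; exact: ball_open.
Qed.

(** Continuity of the inverse chart pulls [W] back to a neighborhood in Euclidean space, which
    contains a rational ball around the image of [x]. *)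
Lemma chart_ball_basis (W : set M) x : nbhs x W ->
  exists2 i, chart_ball i x & chart_ball i `<=` W.
Proof.
move=> Wx; have [c xc] := core_covers (cm_good M) x.
have xd := core_sub (cm_good M) xc.
pose D := chart_img (cm_atlas M) (core_chart c).
have Dx : D (chart (core_chart c) x) by exists x.
have nW : nbhs (chart (core_chart c) x) (chart_inv (core_chart c) @^-1` W).
  apply: (atlas_inv_cont (cm_smooth M) Dx).
  by rewrite (atlas_chartK (cm_smooth M) xd).
have [q [k [qx qW]]] := nbhs_rational_ball nW.
exists (c, q, k) => // y [/= yd /qW] /=.
by rewrite (atlas_chartK (cm_smooth M) yd).
Qed.

(* Only one factor has to be second countable. *)
Lemma open_prod_measurable (T : ptopologicalType) (W : set (M * T)) :
  open W -> measurable (W : set (borel M * borel T)%type).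
Proof.
move=> oW.
(* [V i] is the largest open set whose product with [chart_ball i] lies in [W]. Being open it is
   Borel, however many sets are united, so only the union over [i] has to be countable. *)
pose V i := \bigcup_(B in [set B | open B /\ chart_ball i `*` B `<=` W]) B.
have -> : W = \bigcup_i (chart_ball i `*` V i).
  apply/seteqP; split=> [[x y] Wxy|[x y] [i _ [/= xi [B [_ BW] By]]]].
    have [[A B]/= [xA yB] ABW] := open_nbhs_nbhs (conj oW Wxy).
    have [i xi iA] := chart_ball_basis xA.
    exists i => //; split=> //=; exists B^° => /=; last exact: yB.
    split; first exact: open_interior.
    by move=> [x' y'] [/= /iA Ax /interior_subset By]; exact: ABW.
  by apply: BW; split.
apply: countable_bigcupT_measurable; first exact: countableP.
move=> i; apply: measurableX; apply: sub_sigma_algebra.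
  exact: chart_ball_open.
by apply: bigcup_open => B [].
Qed.

Lemma continuous_prod_measurable_fun (T : ptopologicalType) (g : M * T -> R) :
  continuous g ->
  measurable_fun setT (g : (borel M * borel T)%type -> R).
Proof.
move=> /continuousP cg; apply: (measurability _ (RGenOpens.measurableE R)).
move=> _ [_ [a [b ->] <-]]; rewrite setTI; apply: open_prod_measurable.
exact/cg/interval_open.
Qed.

End second_countability.

Lemma continuous_borel_measurable_fun (R : realType) (T : ptopologicalType)
  (g : T -> R) : continuous g -> measurable_fun setT (g : borel T -> R).
Proof.
move=> /continuousP cg; apply: (measurability _ (RGenOpens.measurableE R)).
move=> _ [_ [a [b ->] <-]]; rewrite setTI; apply: sub_sigma_algebra.
exact/cg/interval_open.
Qed.

(** * Partial derivatives along affine maps *)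

Section partials_affine.
Variable R : realType.

(** Both difference quotients are the same function of [t]. The hypothesis makes [a] affine with
    linear part [L]; it is used for row vectors with one block fixed and for lines. *)
Lemma derive_comp_affine (V W : normedModType R) (a L : V -> W)
    (h : W -> R) z v :
  (forall (t : R) u w, a (t *: u + w) = t *: L u + a w) ->
  (derivable h (a z) (L v) -> derivable (h \o a) z v) /\
  'D_v (h \o a) z = 'D_(L v) h (a z).
Proof.
move=> aL.
have E : (fun t : R => t^-1 *: (((h \o a) \o shift z) (t *: v) - (h \o a) z))
    = (fun t : R => t^-1 *: ((h \o shift (a z)) (t *: L v) - h (a z))).
  by apply/funext => t /=; rewrite aL.
by rewrite /derivable /derive E.
Qed.

Variables (n p : nat) (h : 'rV[R]_(n + p) -> R).

Let row_mx_affinel (w : 'rV[R]_p) (t : R) (u z : 'rV[R]_n) :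
  row_mx (t *: u + z) w = t *: row_mx u 0 + row_mx z w.
Proof. by rewrite scale_row_mx add_row_mx scaler0 add0r. Qed.

Let row_mx_affiner (z : 'rV[R]_n) (t : R) (u w : 'rV[R]_p) :
  row_mx z (t *: u + w) = t *: row_mx 0 u + row_mx z w.
Proof. by rewrite scale_row_mx add_row_mx scaler0 add0r. Qed.

Let row_mx_deltal (i : 'I_n) :
  row_mx (delta_mx 0 i) 0 = delta_mx 0 (lshift p i) :> 'rV[R]_(n + p).
Proof.
apply/rowP => j; case: (split_ordP j) => k ->;
  by rewrite ?row_mxEl ?row_mxEr !mxE ?eq_lshift ?eq_rlshift.
Qed.

Let row_mx_deltar (i : 'I_p) :
  row_mx 0 (delta_mx 0 i) = delta_mx 0 (rshift n i) :> 'rV[R]_(n + p).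
Proof.
apply/rowP => j; case: (split_ordP j) => k ->;
  by rewrite ?row_mxEl ?row_mxEr !mxE ?eq_rshift ?eq_lrshift.
Qed.

(** The linear part of fixing a block sends unit vectors to unit vectors, so only the indices of the
    directions shift. *)
Lemma partials_row_mxl (w : 'rV[R]_p) (s : seq 'I_n) :
  partials s (fun z => h (row_mx z w)) =
  fun z => partials (map (lshift p) s) h (row_mx z w).
Proof.
elim: s => // i s IH; apply/funext => z; rewrite /= IH.
rewrite (@derive_comp_affine _ _ (row_mx^~ w) (row_mx^~ 0) _ z _ _).2 //.
by rewrite row_mx_deltal.
Qed.

Lemma partials_row_mxr (z : 'rV[R]_n) (s : seq 'I_p) :
  partials s (fun w => h (row_mx z w)) =
  fun w => partials (map (@rshift n p) s) h (row_mx z w).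
Proof.
elim: s => // i s IH; apply/funext => w; rewrite /= IH.
rewrite (@derive_comp_affine _ _ (row_mx z) (row_mx 0) _ w _ _).2 //.
by rewrite row_mx_deltar.
Qed.

Lemma derivable_row_mxl (g : 'rV[R]_(n + p) -> R) w z i :
  derivable g (row_mx z w) (delta_mx 0 (lshift p i)) ->
  derivable (fun z => g (row_mx z w)) z (delta_mx 0 i).
Proof.
rewrite -row_mx_deltal => dg.
exact: (@derive_comp_affine _ _ (row_mx^~ w) (row_mx^~ 0) _ z _ _).1.
Qed.

Lemma Ck_on_row_mxr (U : set 'rV[R]_(n + p)) k z :
  Ck_on U k h -> Ck_on (row_mx z @^-1` U) k (fun w => h (row_mx z w)).
Proof.
move=> hC s sk; rewrite partials_row_mxr.
have sk' : (size (map (@rshift n p) s) <= k)%N by rewrite size_map.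
have [hc hd] := hC _ sk'.
split=> [w Uw|ss w Uw i].
  apply: (@continuous_comp _ _ _ (row_mx z)); last exact: hc.
  apply: (@row_mx_cont _ _ n p (fun=> z) id); last exact: cvg_id.
  exact: cst_continuous.
apply: (@derive_comp_affine _ _ (row_mx z) (row_mx 0) _ w _ _).1 => //.
by rewrite row_mx_deltar; apply: hd => //; rewrite size_map.
Qed.

End partials_affine.

Lemma near_eq_continuous (T U : topologicalType) (f g : T -> U) (x : T) :
  {near x, f =1 g} -> {for x, continuous f} -> {for x, continuous g}.
Proof.
move=> fg; rewrite /prop_for /continuous_at -(nbhs_singleton fg).
exact: cvg_trans (near_eq_cvg fg).
Qed.

(** * Functions of class C^r and their norms *)

Section Cr_functions.
Variables (R : realType) (M : compactManifold R).

Lemma Cr_le (r r' : nat) (B : M -> R) : (r <= r')%N -> Cr r' B -> Cr r B.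
Proof.
move=> rr' CB i s sr; have [Bc Bd] := CB i s (leq_trans sr rr').
by split=> // ss; apply: Bd; exact: leq_trans ss rr'.
Qed.

Lemma Cr_continuous (r : nat) (B : M -> R) : Cr r B -> continuous B.
Proof.
move=> CB x; have [i xi] := atlas_cover (cm_smooth M) x.
have [Bc _] := CB i [::] (leq0n r).
have nxi : nbhs x (chart_dom i).
  by apply: open_nbhs_nbhs; split=> //; exact: atlas_dom_open (cm_smooth M) _.
have E : {near x, (B \o chart_inv i) \o chart i =1 B}.
  by apply: filterS nxi => y yi /=; rewrite (atlas_chartK (cm_smooth M) yi).
apply: (near_eq_continuous E).
apply: (@continuous_comp _ _ _ (chart i)).
  exact: atlas_chart_cont (cm_smooth M) _ _ xi.
by apply: Bc; exists x.
Qed.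

(** The supremum in [Cr_norm] is informative only for a bounded set. Boundedness comes from
    continuity of the partial derivatives and compactness of the cores. *)
Lemma Cr_partials_bounded (r : nat) (B : M -> R) : Cr r B ->
  exists K : R, forall c (s : seq 'I_(cm_dim M)) (x : M),
    (size s <= r)%N -> core (c := cm_cover M) c x ->
    `|partials s (B \o chart_inv (core_chart c)) (chart (core_chart c) x)| <= K.
Proof.
move=> CB.
pose P (c : core_idx (cm_cover M)) (s : seq 'I_(cm_dim M)) (K : R) (x : M) :=
  `|partials s (B \o chart_inv (core_chart c)) (chart (core_chart c) x)| <= K.
(* Lists are replaced by tuples so that every index ranges over a finite type; then it suffices to
   find a bound for each index separately. *)
have : \forall K \near +oo, forall (c : core_idx (cm_cover M)) (k : 'I_r.+1)
    (s : k.-tuple 'I_(cm_dim M)), core c `<=` P c s K.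
  apply: filter_forall => c; apply: filter_forall => k.
  apply: filter_forall => s.
  have /compact_near_coveringP := core_compact (cm_good M) (c := c).
  apply=> x xc; have xd := core_sub (cm_good M) xc.
  have sr : (size s <= r)%N by rewrite size_tuple -ltnS.
  have [Bc _] := CB (core_chart c) s sr.
  set g := partials s _ in Bc.
  pose gc := g \o chart (core_chart c).
  have gx : {for x, continuous gc}.
    apply: continuous_comp; first exact: atlas_chart_cont (cm_smooth M) _ _ xd.
    by apply: Bc; exists x.
  have /cvgr_dist_lt/(_ 1 ltr01) gx1 := gx.
  exists ([set y | `|gc x - gc y| < 1], [set K | `|gc x| + 1 <= K]).
    by split=> //=; exact: nbhs_pinfty_ge.
  move=> [y K] /= [gxy gK]; rewrite /P /=; apply: le_trans gK.
  rewrite -/g -[X in `|X| <= _](subrK (gc x)).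
  by rewrite addrC (le_trans (ler_normD _ _))// lerD2l distrC ltW.
move=> [K [_ /(_ (K + 1))]]; rewrite ltrDl ltr01 => /(_ isT) H.
exists (K + 1) => c s x sr xc.
exact: (H c (Ordinal (leq_ltn_trans sr (ltnSn r))) (in_tuple s)).
Qed.

Lemma Cr_norm_ub (r : nat) (B : M -> R) c (s : seq 'I_(cm_dim M)) (x : M) :
  Cr r B -> (size s <= r)%N -> core (c := cm_cover M) c x ->
  `|partials s (B \o chart_inv (core_chart c)) (chart (core_chart c) x)| <=
  Cr_norm r B.
Proof.
move=> CB sr xc; have [K BK] := Cr_partials_bounded CB.
apply: ub_le_sup; last by exists c, s, x.
by exists K => _ [c' [s' [x' [s'r xc' ->]]]]; exact: BK.
Qed.

Lemma Cr_norm_le (r : nat) (B : M -> R) (K : R) :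
  (forall c (s : seq 'I_(cm_dim M)) (x : M),
    (size s <= r)%N -> core (c := cm_cover M) c x ->
    `|partials s (B \o chart_inv (core_chart c)) (chart (core_chart c) x)| <= K)
  -> Cr_norm r B <= K.
Proof.
move=> BK; apply: ge_sup; last by move=> _ [c [s [x [sr xc ->]]]]; exact: BK.
have [c xc] := core_covers (cm_good M) point.
by eexists; exists c, [::], point.
Qed.

Lemma Cr_norm_mono (r r' : nat) (B : M -> R) : (r <= r')%N -> Cr r' B ->
  Cr_norm r B <= Cr_norm r' B.
Proof.
move=> rr' CB; apply: Cr_norm_le => c s x sr xc.
by apply: Cr_norm_ub => //; exact: leq_trans sr rr'.
Qed.

(** The empty list of directions puts the values of [B] under the supremum, and the cores cover
    [M]. *)
Lemma normr_le_Cr_norm (r : nat) (B : M -> R) x : Cr r B ->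
  `|B x| <= Cr_norm r B.
Proof.
move=> CB; have [c xc] := core_covers (cm_good M) x.
have := @Cr_norm_ub r B c [::] x CB (leq0n r) xc.
by rewrite /= (atlas_chartK (cm_smooth M) (core_sub (cm_good M) xc)).
Qed.

Lemma Cr_norm_ge0 (r : nat) (B : M -> R) : Cr r B -> 0 <= Cr_norm r B.
Proof. by move=> /(normr_le_Cr_norm point); exact: le_trans. Qed.

End Cr_functions.

(** * Sections of a function on the product *)

Section sections.
Variables (R : realType) (X Y : compactManifold R) (A : X * Y -> R).
Local Notation XY := (prod_manifold X Y).
Local Notation pchart_inv i j :=
  (@chart_inv _ _ _ (prod_atlas (cm_atlas X) (cm_atlas Y)) (i, j)).

(** Read in a product chart, the section is [A] with the second block frozen at [chart j y]. *)
Lemma partials_section1 (i : chart_idx (cm_atlas X))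
    (j : chart_idx (cm_atlas Y)) (y : Y) (s : seq 'I_(cm_dim X)) z : chart_dom j y ->
  partials s (fun z => A (chart_inv i z, y)) z =
  partials (map (lshift (cm_dim Y)) s) (A \o pchart_inv i j)
    (row_mx z (chart j y)).
Proof.
move=> yj; have -> : (fun z => A (chart_inv i z, y)) =
    fun z => (A \o pchart_inv i j) (row_mx z (chart j y)).
  apply/funext => w /=.
  by rewrite row_mxKl row_mxKr (atlas_chartK (cm_smooth Y) yj).
by rewrite partials_row_mxl.
Qed.

Lemma section2E (i : chart_idx (cm_atlas X)) (j : chart_idx (cm_atlas Y))
    (x : X) : chart_dom i x ->
  (fun y => A (x, y)) \o chart_inv j =
  fun w => (A \o pchart_inv i j) (row_mx (chart i x) w).
Proof.
move=> xi; apply/funext => w /=.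
by rewrite row_mxKl row_mxKr (atlas_chartK (cm_smooth X) xi).
Qed.

Lemma Cr_section2 (r : nat) (x : X) :
  Cr (M := XY) r A -> Cr (M := Y) r (fun y => A (x, y)).
Proof.
move=> CA j; have [i xi] := atlas_cover (cm_smooth X) x.
rewrite (section2E j xi).
apply: Ck_on_sub (Ck_on_row_mxr (chart i x) (CA (i, j))).
by move=> _ [y yj <-]; exists (x, y).
Qed.

(** The cores of the product are products of cores, so with [x] in some core each derivative of the
    section is among those that define the norm of [A]. *)
Lemma Cr_norm_section2 (r : nat) (x : X) : Cr (M := XY) r A ->
  Cr_norm (M := Y) r (fun y => A (x, y)) <= Cr_norm (M := XY) r A.
Proof.
move=> CA; apply: Cr_norm_le => c s y sr yc.
have [b xb] := core_covers (cm_good X) x.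
rewrite (section2E _ (core_sub (cm_good X) xb)) partials_row_mxr.
apply: (@Cr_norm_ub _ XY r A (b, c) (map (@rshift _ _) s) (x, y)) => //.
by rewrite size_map.
Qed.

End sections.

(** * Integrals of bounded functions against a probability *)

Section bounded_integrals.
Variables (R : realType) (d : measure_display) (T : measurableType d).
Variable P : probability T R.

Lemma bounded_integrable (g : T -> R) (K : R) : measurable_fun setT g ->
  (forall x, `|g x| <= K) -> P.-integrable setT (EFin \o g).
Proof.
move=> mg gK; apply: measurable_bounded_integrable => //.
  by rewrite (le_lt_trans (probability_le1 P _)) ?ltry.
exists K; split; first exact: num_real.
by move=> N KN x _; apply: le_trans (gK x) (ltW KN).
Qed.

Lemma Rintegral_prob_cst (K : R) : \int[P]_x K = K.
Proof. by rewrite Rintegral_cst// [X in fine X]probability_setT mulr1. Qed.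

Lemma normr_Rintegral_bounded (g : T -> R) (K : R) : measurable_fun setT g ->
  (forall x, `|g x| <= K) -> `|\int[P]_x g x| <= K.
Proof.
move=> mg gK; apply: le_trans (le_normr_Rintegral _ _) _ => //.
  exact: bounded_integrable gK.
rewrite -[leRHS]Rintegral_prob_cst; apply: le_Rintegral => //.
- apply: (@bounded_integrable _ K); first exact: measurableT_comp.
  by move=> x; rewrite normr_id.
- by apply: (@bounded_integrable _ `|K|) => //.
Qed.

End bounded_integrals.

(** * Continuity and differentiation under the integral *)

Section parametrized.
Variable R : realType.

(** A tube lemma argument: joint continuity at each [(z, y)] gives a product neighborhood, and
    compactness of [T] makes the first factor uniform in [y]. *)
Lemma near_uniform_compact (Z T : topologicalType) (phi : Z * T -> R) (z : Z) :
  compact [set: T] -> (forall y, {for (z, y), continuous phi}) ->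
  forall e : R, 0 < e ->
  \forall z' \near z, forall y, `|phi (z', y) - phi (z, y)| < e.
Proof.
move=> /compact_near_coveringP cT phic e e0.
suff : \forall z' \near z, [set: T] `<=`
    fun y => `|phi (z', y) - phi (z, y)| < e.
  by apply: filterS => z' H y; exact: H.
apply: cT => y _; have e2 : 0 < e / 2 by rewrite divr_gt0.
have /cvgr_dist_lt/(_ _ e2) [[A B]/= [zA yB] AB] := phic y.
exists (B, A) => //= -[y' z'] /= [By' Az'].
(* Both [(z', y')] and [(z, y')] are compared with [(z, y)], each at cost [e / 2]. *)
rewrite (splitr e) (le_lt_trans (ler_distD (phi (z, y)) _ _))// ltrD//.
  by rewrite distrC; exact: (AB (z', y') (conj Az' By')).
by apply: (AB (z, y')); split=> //=; exact: nbhs_singleton zA.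
Qed.

Lemma continuous_section2 (Z T : topologicalType) (phi : Z * T -> R) (z : Z) :
  (forall y, {for (z, y), continuous phi}) -> continuous (fun y => phi (z, y)).
Proof.
move=> phic y; apply: (@continuous_comp _ _ _ (pair z) phi); last exact: phic.
by apply: cvg_pair => //; exact: cvg_cst.
Qed.

Variables (T : ptopologicalType) (P : probability (borel T) R).
Hypothesis cT : compact [set: T].

Lemma compact_continuous_bounded (g : T -> R) : continuous g ->
  exists K, forall y, `|g y| <= K.
Proof.
move=> cg; have : bounded_set (g @` setT).
  apply: compact_bounded; apply: continuous_compact => //.
  exact: continuous_subspaceT.
move=> [K [_ /(_ (K + 1))]]; rewrite ltrDl ltr01 => /(_ isT) H.
by exists (K + 1) => y; apply: H; exists y.
Qed.

Lemma continuous_integrable (g : T -> R) : continuous g ->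
  P.-integrable setT (EFin \o (g : borel T -> R)).
Proof.
move=> cg; have [K gK] := compact_continuous_bounded cg.
apply: (@bounded_integrable _ _ _ _ _ K) => //.
exact: continuous_borel_measurable_fun.
Qed.

(** The integrands converge uniformly by [near_uniform_compact]. Continuity is asked at all [z']
    near [z] so that the sections at [z'] are integrable. *)
Lemma continuous_Rintegral (Z : topologicalType) (phi : Z * T -> R) (z : Z) :
  (\forall z' \near z, forall y, {for (z', y), continuous phi}) ->
  {for z, continuous (fun z' => \int[P]_y phi (z', y))}.
Proof.
move=> phic; apply/cvgrPdist_le => e e0.
have phic0 := nbhs_singleton phic.
apply: filterS2 phic (near_uniform_compact cT phic0 e0) => z' phic' phie.
rewrite -RintegralB//; [|exact/continuous_integrable/continuous_section2..].
apply: normr_Rintegral_bounded.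
  apply: measurable_funB; apply: continuous_borel_measurable_fun;
  exact: continuous_section2.
by move=> y; rewrite distrC ltW.
Qed.

(** The one-variable mean value theorem on a line. Both signs of [t] are covered because derivatives
    are two-sided limits. *)
Lemma MVT_line (W : normedModType R) (h : W -> R) (z e : W) (t : R) :
  (forall s : R, `|s| <= `|t| -> derivable h (s *: e + z) e) ->
  exists2 s : R, `|s| <= `|t| & h (t *: e + z) - h z = 'D_e h (s *: e + z) * t.
Proof.
move=> hd; pose g (s : R) := h (s *: e + z).
have gd (s : R) : `|s| <= `|t| -> is_derive s 1 g ('D_e h (s *: e + z)).
  move=> st.
  have aL (t' : R) (u w : R^o) :
      (t' *: u + w) *: e + z = t' *: (u *: e) + (w *: e + z).
    by rewrite scalerDl scalerA addrA.
  have [H1 H2] := @derive_comp_affine R R^o W (fun s => s *: e + z)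
    (fun u => u *: e) h s 1 aL.
  rewrite scale1r in H1 H2; apply: DeriveDef; last exact: H2.
  by apply: H1; exact: hd.
have gab (a b : R) : a <= b -> (forall s, s \in `[a, b] -> `|s| <= `|t|) ->
    exists2 s, `|s| <= `|t| & g b - g a = 'D_e h (s *: e + z) * (b - a).
  move=> ab H.
  have [s sab E] := @MVT_segment _ g (fun s => 'D_e h (s *: e + z)) a b ab
    (fun x xab => gd x (H x (subset_itv_oo_cc xab)))
    (derivable_within_continuous
      (fun x xab => @ex_derive _ _ _ _ _ _ _ (gd x (H x xab)))).
  by exists s => //; exact: H.
have g0 : h z = g 0 by rewrite /g scale0r add0r.
rewrite g0 -/(g t); have [t0|t0] := leP 0 t.
  have [|s st ->] := gab 0 t t0; last by exists s; rewrite ?subr0.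
  by move=> s; rewrite in_itv/= => /andP[s0 st]; rewrite !ger0_norm.
(* For negative [t] the segment runs from [t] to 0, and both differences change sign. *)
have [|s st E] := gab t 0 (ltW t0).
  move=> s; rewrite in_itv/= => /andP[s0 st].
  by rewrite (ltr0_norm t0) ler0_norm// lerN2.
exists s => //; rewrite -opprB E sub0r mulrN opprK //.
Qed.

(* By the mean value theorem the difference quotient is a value of the
   derivative at a nearby point, and the derivative varies uniformly on [T]. *)
Lemma derive_Rintegral (W : normedModType R) (U : set W)
    (phi phi' : W * T -> R) (z e : W) :
  open U -> U z ->
  (forall w y, U w -> {for (w, y), continuous phi}) ->
  (forall y, {for (z, y), continuous phi'}) ->
  (forall w y, U w -> is_derive w e (fun w => phi (w, y)) (phi' (w, y))) ->
  is_derive z e (fun w => \int[P]_y phi (w, y)) (\int[P]_y phi' (z, y)).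
Proof.
move=> oU Uz phic phic' phid.
set Phi := fun w => _.
suff H : t^-1 *: ((Phi \o shift z) (t *: e) - Phi z) @[t --> 0^'] -->
    \int[P]_y phi' (z, y).
  apply: DeriveDef; first by apply/cvg_ex; eexists; exact: H.
  exact: cvg_lim H.
apply/cvgrPdist_le => eps eps0.
have nz : \forall w \near z, U w /\
    forall y, `|phi' (w, y) - phi' (z, y)| < eps.
  apply: filterI; first exact: open_nbhs_nbhs.
  exact: near_uniform_compact.
have lc : (fun t : R => t *: e + z) @ 0 --> z.
  rewrite -[X in _ --> X]add0r -[X in _ --> X + _](scale0r e).
  by apply: cvgD; [exact: scalel_continuous|exact: cvg_cst].
have /nbhs_ballP[r /= r0 rS] := lc _ nz.
rewrite near_withinE; apply/nbhs_ballP; exists r => //= t.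
rewrite /ball/= sub0r normrN => tr t0.
(* The mean value point [s] is no larger than [t] in absolute value, so it falls in the same ball
   around 0. *)
have sP s : `|s| <= `|t| -> U (s *: e + z) /\
    forall y, `|phi' (s *: e + z, y) - phi' (z, y)| < eps.
  by move=> st; apply: rS; rewrite /ball/= sub0r normrN (le_lt_trans st).
have [Ut _] := sP t (lexx _).
have c1 : continuous (fun y => phi (t *: e + z, y)).
  by apply: continuous_section2 => y; exact: phic.
have c2 : continuous (fun y => phi (z, y)).
  by apply: continuous_section2 => y; exact: phic.
have c3 := continuous_section2 phic'.
have c4 : continuous (fun y => phi (t *: e + z, y) - phi (z, y)).
  by move=> y; apply: cvgB; [exact: c1|exact: c2].
have c5 : continuous (fun y => t^-1 * (phi (t *: e + z, y) - phi (z, y))).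
  by move=> y; apply: cvgM; [exact: cvg_cst|exact: c4].
rewrite /Phi/= -RintegralB//; [|exact: continuous_integrable..].
rewrite [X in _ - X](_ : _ =
  t^-1 * \int[P]_x (phi (t *: e + z, x) - phi (z, x)))//.
rewrite -RintegralZl//; last exact: continuous_integrable.
rewrite -RintegralB//; [|exact: continuous_integrable..].
apply: normr_Rintegral_bounded.
  by apply: measurable_funB; exact: continuous_borel_measurable_fun.
move=> y; have [s st|s st ->] := @MVT_line _ (fun w => phi (w, y)) z e t.
  have [Us _] := sP s st; exact: (@ex_derive _ _ _ _ _ _ _ (phid _ y Us)).
have [Us sy] := sP s st.
have -> := @derive_val _ _ _ _ _ _ _ (phid _ y Us).
by rewrite mulrCA mulVf// mulr1 distrC ltW.
Qed.

End parametrized.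

(** * Averages over the fibers *)

Section fiber_average.
Variables (R : realType) (X Y : compactManifold R).
Variables (nu : probability (borel Y) R) (A : X * Y -> R) (r : nat).
Local Notation XY := (prod_manifold X Y).
Hypothesis CA : Cr (M := XY) r A.

(** The derivatives of the sections form one function of the pair, since differentiation under the
    integral asks for continuity in both variables. *)
Let g (i : chart_idx (cm_atlas X)) (s : seq 'I_(cm_dim X))
    (zy : 'rV[R]_(cm_dim X) * Y) : R :=
  partials s (fun z => A (chart_inv i z, zy.2)) zy.1.

(** A chart of [Y] around [y] turns [g i s] into a partial derivative of [A] in a product chart, but
    only near [(z, y)]. *)
Let g_cont i s z y : (size s <= r)%N -> chart_img (cm_atlas X) i z ->
  {for (z, y), continuous (g i s)}.
Proof.
move=> sr iz; have [j yj] := atlas_cover (cm_smooth Y) y.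
set h := (A \o @chart_inv _ _ _ (prod_atlas (cm_atlas X) (cm_atlas Y)) (i, j)).
set a := (fun zy : 'rV[R]_(cm_dim X) * Y => row_mx zy.1 (chart j zy.2)).
have E : {near (z, y), partials (map (lshift (cm_dim Y)) s) h \o a =1 g i s}.
  exists (setT, chart_dom j); last first.
    by move=> [w v] /= [_ vj]; rewrite /g /= (partials_section1 _ _ _ _ vj).
  split; first exact: filterT.
  by apply: open_nbhs_nbhs; split=> //; exact: atlas_dom_open (cm_smooth Y) _.
apply: (near_eq_continuous E).
apply: (@continuous_comp _ _ _ a).
  apply: row_mx_cont; first exact: cvg_fst.
  apply: (@continuous_comp _ _ _ snd (chart j)); first exact: cvg_snd.
  exact: atlas_chart_cont (cm_smooth Y) _ _ yj.
have sr' : (size (map (lshift (cm_dim Y)) s) <= r)%N by rewrite size_map.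
have [hc _] := CA (i, j) sr'.
apply: hc; have [x xi <-] := iz.
by exists (x, y).
Qed.

Let g_derive i s z y k : (size s < r)%N -> chart_img (cm_atlas X) i z ->
  is_derive z (delta_mx 0 k) (fun z => g i s (z, y)) (g i (k :: s) (z, y)).
Proof.
move=> sr iz; apply: DeriveDef => //.
have [j yj] := atlas_cover (cm_smooth Y) y.
have -> : (fun z => g i s (z, y)) = fun z =>
    partials (map (lshift (cm_dim Y)) s)
    (A \o @chart_inv _ _ _ (prod_atlas (cm_atlas X) (cm_atlas Y)) (i, j))
    (row_mx z (chart j y)).
  by apply/funext => w; exact: partials_section1.
apply: derivable_row_mxl.
have sr' : (size (map (lshift (cm_dim Y)) s) <= r)%N by rewrite size_map ltnW.
have [_ hd] := CA (i, j) sr'.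
apply: hd; first by rewrite size_map.
by have [x xi <-] := iz; exists (x, y).
Qed.

(** The strict bound on [size s] leaves room for one more derivative, so [g i (k :: s)] is still
    continuous. *)
Let average_derive i s z k : (size s < r)%N -> chart_img (cm_atlas X) i z ->
  is_derive z (delta_mx 0 k) (fun z => \int[nu]_y g i s (z, y))
    (\int[nu]_y g i (k :: s) (z, y)).
Proof.
move=> sr iz.
have oU : open (chart_img (cm_atlas X) i).
  exact: atlas_img_open (cm_smooth X) _.
have := @derive_Rintegral R Y nu (@cm_compact R Y) _ _ (g i s) (g i (k :: s)) z
  (delta_mx 0 k) oU iz; apply.
- by move=> w y iw; apply: g_cont => //; exact: ltnW.
- by move=> y; exact: g_cont.
- by move=> w y iw; exact: g_derive.
Qed.

(** Induction on [s]. The induction hypothesis holds on the chart image, which is open, and so it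
    determines the next derivative there. *)
Lemma partials_fiber_average i s z : (size s <= r)%N ->
  chart_img (cm_atlas X) i z ->
  partials s ((fun x => \int[nu]_y A (x, y)) \o chart_inv i) z =
  \int[nu]_y partials s (fun z => A (chart_inv i z, y)) z.
Proof.
elim: s z => [|k s IH] z sr iz //=.
have oU : open (chart_img (cm_atlas X) i).
  exact: atlas_img_open (cm_smooth X) _.
rewrite (@near_eq_derive _ _ _ _
  (fun w => \int[nu]_y g i s (w, y))); last first.
  have : \forall w \near z, chart_img (cm_atlas X) i w by exact: open_nbhs_nbhs.
  by apply: filterS => w iw; rewrite IH// ltnW.
exact: (@derive_val _ _ _ _ _ _ _ (average_derive k sr iz)).
Qed.

Lemma Cr_fiber_average : Cr (M := X) r (fun x => \int[nu]_y A (x, y)).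
Proof.
move=> i s sr; have oU : open (chart_img (cm_atlas X) i).
  exact: atlas_img_open (cm_smooth X) _.
have nE z : chart_img (cm_atlas X) i z -> {near z,
    (fun w => \int[nu]_y g i s (w, y)) =1
    partials s ((fun x => \int[nu]_y A (x, y)) \o chart_inv i)}.
  move=> iz; have : \forall w \near z, chart_img (cm_atlas X) i w.
    exact: open_nbhs_nbhs.
  by apply: filterS => w iw; rewrite partials_fiber_average.
split=> [z iz|ss z iz k].
  apply: (near_eq_continuous (nE z iz)).
  have := @continuous_Rintegral R Y nu (@cm_compact R Y) _ (g i s) z; apply.
  have : \forall w \near z, chart_img (cm_atlas X) i w by exact: open_nbhs_nbhs.
  by apply: filterS => w iw y; exact: g_cont.
apply: near_eq_derivable (nE z iz) _.
exact: (@ex_derive _ _ _ _ _ _ _ (average_derive k ss iz)).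
Qed.

(** For each [y] the integrand is a derivative of [A] at a point of a product core, and averaging
    keeps the bound. *)
Lemma Cr_norm_fiber_average :
  Cr_norm (M := X) r (fun x => \int[nu]_y A (x, y)) <= Cr_norm (M := XY) r A.
Proof.
apply: Cr_norm_le => c s x sr xc.
have ix : chart_img (cm_atlas X) (core_chart c) (chart (core_chart c) x).
  by exists x => //; exact: core_sub (cm_good X) _ _ xc.
rewrite partials_fiber_average//; apply: normr_Rintegral_bounded.
  apply: continuous_borel_measurable_fun.
  apply: (continuous_section2 (phi := g (core_chart c) s)) => y.
  exact: g_cont.
move=> y; have [b yb] := core_covers (cm_good Y) y.
rewrite (partials_section1 _ _ _ _ (core_sub (cm_good Y) yb)).
apply: (@Cr_norm_ub _ XY r A (c, b) (map (lshift _) s) (x, y)) => //.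
by rewrite size_map.
Qed.

End fiber_average.

(** * Splitting the correlations of the skew product *)

Section skew_product_correlations.
Variables (R : realType) (k : nat) (X Y : compactManifold R).
Variables (mu : probability (borel X) R) (nu : probability (borel Y) R).
Variables (f : X -> X) (G : 'rV[R]_k -> Y -> Y) (tau : X -> 'rV[R]_k).
Hypothesis f_cont : continuous f.
Hypothesis tau_cont : continuous tau.
Hypothesis G_flow : smooth_flow G.
Local Notation bsum := (@birkhoff_sum R _ (borel X) f k tau).

Let G_cont : continuous (fun ty : 'rV[R]_k * Y => G ty.1 ty.2).
Proof. exact: (flow_smooth G_flow).1. Qed.

(** The flow law adds up the times met along the orbit of [x], which produces the Birkhoff sum. *)
Lemma iter_skew_product N xy : iter N (skew_product f G tau) xy =
  (iter N f xy.1, G (bsum N xy.1) xy.2).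
Proof.
case: xy => x y; elim: N => [|N IH] /=.
  by rewrite /birkhoff_sum big_geq// (flow0 G_flow).
rewrite IH /skew_product /= /birkhoff_sum big_nat_recr//= addrC.
by rewrite (flowD G_flow).
Qed.

Lemma iter_continuous N : continuous (iter N f).
Proof.
elim: N => [|N IH] x /=; first exact: cvg_id.
by apply: (@continuous_comp _ _ _ (iter N f) f); [exact: IH|exact: f_cont].
Qed.

Lemma birkhoff_sum_continuous N : continuous (bsum N).
Proof.
elim: N => [|N IH] x.
  rewrite (_ : bsum 0 = fun=> 0); first exact: cvg_cst.
  by apply/funext => z; rewrite /birkhoff_sum big_geq.
rewrite (_ : bsum N.+1 =
  fun x => bsum N x + tau (iter N f x)).
  apply: cvgD; first exact: IH.
  apply: (@continuous_comp _ _ _ (iter N f) tau); last exact: tau_cont.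
  exact: iter_continuous.
by apply/funext => z; rewrite /birkhoff_sum big_nat_recr.
Qed.

Lemma measurable_deviation_set N eps :
  measurable (deviation_set mu f tau N eps : set (borel X)).
Proof.
pose g x := `|N%:R^-1 *: bsum N x - mean mu tau|.
have cg : continuous g.
  move=> x; apply: cvg_norm; apply: cvgB; last exact: cvg_cst.
  by apply: cvgZ; [exact: cvg_cst|exact: birkhoff_sum_continuous].
rewrite (_ : deviation_set _ _ _ _ _ = setT `&` g @^-1` `[eps, +oo[).
  by apply: continuous_borel_measurable_fun.
by apply/seteqP; split=> [x H|x [_]]; rewrite /= in_itv/= andbT.
Qed.

Lemma skew_iter_continuous N :
  continuous (fun xy : X * Y => (iter N f xy.1, G (bsum N xy.1) xy.2)).
Proof.
move=> xy; apply: cvg_pair => /=.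
  apply: (@continuous_comp _ _ _ fst (iter N f)); first exact: cvg_fst.
  exact: iter_continuous.
have c : {for xy, continuous (fun xy : X * Y => (bsum N xy.1, xy.2))}.
  have c1 : {for xy, continuous (bsum N \o fst)}.
    apply: continuous_comp; first exact: cvg_fst.
    exact: birkhoff_sum_continuous.
  have c2 : {for xy, continuous (@snd X Y)} by exact: cvg_snd.
  exact: cvg_pair c1 c2.
exact: (continuous_comp c (@G_cont _)).
Qed.

(** Fubini for continuous functions, which are bounded because [X * Y] is compact. *)
Lemma Rintegral_prod (h : X * Y -> R) : continuous h ->
  \int[(mu \x nu)%E]_z (h : borel X * borel Y -> R) z =
  \int[mu]_x \int[nu]_y h (x, y).
Proof.
move=> ch; have cXY := compact_prod (@cm_compact _ X) (@cm_compact _ Y).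
have [K hK] := compact_continuous_bounded (T := (X * Y)%type) cXY ch.
have ih : (mu \x nu)%E.-integrable setT
    (EFin \o (h : borel X * borel Y -> R)).
  apply: measurable_bounded_integrable => //.
  - have := product_measure1E mu nu measurableT measurableT.
    rewrite setXTT [X in _ = (X * _)%E]probability_setT.
    rewrite [X in _ = (_ * X)%E]probability_setT mule1 => E.
    by rewrite [X in (X < _)%E]E ltry.
  - exact: continuous_prod_measurable_fun.
  - exists K; split; first exact: num_real.
    by move=> M KM z _; apply: le_trans (hK z) (ltW KM).
(* [Rintegral] takes [fine] of an extended integral, so the inner integrals have to be finite for
   the two sides to agree. *)
rewrite /Rintegral -integral12_prod_meas1//; congr fine.
apply: eq_integral => x _; rewrite /fubini_F fineK//.
apply: integrable_fin_num => //.
have := @continuous_integrable R Y nu (@cm_compact R Y) (fun y => h (x, y)); apply.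
by apply: (continuous_section2 (phi := h)) => y; exact: ch.
Qed.

Variables (A B : X * Y -> R) (a b : R).
Hypotheses (A_cont : continuous A) (B_cont : continuous B).
Hypotheses (Aa : forall xy, `|A xy| <= a) (Bb : forall xy, `|B xy| <= b).

Local Notation average C := (fun x : X => \int[nu]_y C (x, y)).

Let average_cont (C : X * Y -> R) : continuous C -> continuous (average C).
Proof.
move=> cC x; have := @continuous_Rintegral R Y nu (@cm_compact R Y) X C x.
by apply; apply: nearW => x' y; exact: cC.
Qed.

(** [E] is where mixing of [G] may give nothing: there the fiber correlation is bounded by
    [2 * a * b], elsewhere by [K]. The rest is the correlation of the fiber averages under [f]. *)
Lemma corr_skew_product N (E : set X) (K : R) :
  measurable (E : set (borel X)) -> 0 <= K ->
  (forall x, ~ E x -> `|corr nu (G (bsum N x))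
    (fun y => A (x, y)) (fun y => B (iter N f x, y))| <= K) ->
  `|corr (mu \x nu)%E (iter N (skew_product f G tau)) A B| <=
  K + 2 * a * b * fine (mu E) + `|corr mu (iter N f) (average A) (average B)|.
Proof.
move=> mE K0 EK.
pose BF xy := B (iter N f xy.1, G (bsum N xy.1) xy.2).
have cAB : continuous (fun z => A z * BF z).
  move=> z; apply: cvgM; first exact: A_cont.
  apply: (@continuous_comp _ _ _ _ B); last exact: B_cont.
  exact: skew_iter_continuous.
pose I x := \int[nu]_y (A (x, y) * BF (x, y)).
have cI : continuous I := average_cont cAB.
(* [I x - J x] is the correlation of the sections under [G] at time [bsum N x]. The integral of [J],
   subtracted here, is the first term of the correlation of the averages. *)
pose J x := (\int[nu]_y A (x, y)) * (\int[nu]_y B (iter N f x, y)).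
have cJ : continuous J.
  move=> x; apply: cvgM; first exact: average_cont.
  apply: (@continuous_comp _ _ _ (iter N f) (average B)).
    exact: iter_continuous.
  exact: average_cont.
have cD : continuous (fun x => I x - J x).
  by move=> x; apply: cvgB; [exact: cI|exact: cJ].
have -> : corr (mu \x nu)%E (iter N (skew_product f G tau)) A B =
    \int[mu]_x (I x - J x) + corr mu (iter N f) (average A) (average B).
  rewrite /corr RintegralB//;
    [|exact: (continuous_integrable mu (@cm_compact _ X))..].
  rewrite -(Rintegral_prod cAB) -(Rintegral_prod A_cont).
  rewrite -(Rintegral_prod B_cont).
  rewrite addrA subrK; congr (_ - _).
  by apply: eq_Rintegral => z _; rewrite iter_skew_product.
rewrite (le_trans (ler_normD _ _))// lerD2r.
apply: (le_trans (le_normr_Rintegral _ _)) => //.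
  exact: (continuous_integrable mu (@cm_compact _ X)).
have a0 : 0 <= a by exact: le_trans (Aa point).
have b0 : 0 <= b by exact: le_trans (Bb point).
have ab0 : 0 <= 2 * a * b by rewrite !mulr_ge0.
have iE : mu.-integrable setT (EFin \o (fun x : borel X => 2 * a * b * \1_E x)).
  apply: (@bounded_integrable _ _ _ _ _ (2 * a * b)).
    by apply: measurable_funM => //; exact: measurable_indic.
  move=> x; rewrite normrM ger0_norm// ler_piMr// indicE.
  by case: (x \in E); rewrite ?normr1 ?normr0.
have iK : mu.-integrable setT (EFin \o (fun _ : borel X => K)).
  by apply: (@bounded_integrable _ _ _ _ _ `|K|).
have iKE := integrableD measurableT iK iE.
rewrite (@le_trans _ _ (\int[mu]_x (K + 2 * a * b * \1_E x)))//.
  apply: le_Rintegral => //.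
    apply: (continuous_integrable mu (@cm_compact _ X)) => x.
    by apply: cvg_norm; exact: cD.
  move=> x _; rewrite indicE.
  have [xE|xE] := boolP (x \in E); last first.
    by rewrite mulr0 addr0; apply: EK => /mem_set; exact/negP.
  (* On [E] both [I x] and [J x] are at most [a * b] in absolute value, whence the factor 2. *)
  rewrite mulr1 -[leLHS]add0r lerD// (le_trans (ler_normB _ _))//.
  rewrite -mulrA mulr_natl mulr2n; apply: lerD.
    apply: normr_Rintegral_bounded.
      apply: continuous_borel_measurable_fun.
      apply: (continuous_section2 (phi := fun z => A z * BF z)) => y.
      exact: cAB.
    by move=> y; rewrite normrM ler_pM//; exact: Bb.
  rewrite normrM ler_pM//; apply: normr_Rintegral_bounded => //;
  apply: continuous_borel_measurable_fun.
    by apply: (continuous_section2 (phi := A)) => y; exact: A_cont.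
  by apply: (continuous_section2 (phi := B)) => y; exact: B_cont.
rewrite RintegralD// Rintegral_prob_cst lerD2l RintegralZl//; last first.
  apply: (@bounded_integrable _ _ _ _ _ 1).
    exact: measurable_indic.
  by move=> x; rewrite indicE; case: (x \in E); rewrite ?normr1 ?normr0.
by rewrite /Rintegral integral_indic// setIT.
Qed.

End skew_product_correlations.

(** * From rates for [f], [G] and the deviations to a rate for [F] *)

Section skew_product_mixing.
Variables (R : realType) (k : nat) (X Y : compactManifold R).
Variables (mu : probability (borel X) R) (nu : probability (borel Y) R).
Variables (f : X -> X) (G : 'rV[R]_k -> Y -> Y) (tau : X -> 'rV[R]_k).
Hypothesis f_cont : continuous f.
Hypothesis tau_cont : continuous tau.
Hypothesis G_flow : smooth_flow G.
Hypothesis mean_tau : mean mu tau <> 0.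
Local Notation bsum := (@birkhoff_sum R _ (borel X) f k tau).
Local Notation XY := (prod_manifold X Y).
Local Notation m := (`|mean mu tau| / 2).
Local Notation dev N := (deviation_set mu f tau N m).
Local Notation F := (skew_product f G tau).

Lemma half_mean_gt0 : 0 < m.
Proof. by rewrite divr_gt0// normr_gt0; exact/eqP. Qed.

(** Off the deviation set the Birkhoff average is less than half the norm of the mean away from the
    mean, so it keeps at least the other half. For [N = 0] the left side is 0. *)
Lemma birkhoff_sum_large N x : ~ dev N x -> m * N%:R <= `|bsum N x|.
Proof.
case: N => [_|N]; first by rewrite mulr0.
rewrite /deviation_set /= => /negP; rewrite -ltNge => H.
have -> : m * N.+1%:R <= `|bsum N.+1 x| = (m <= `|N.+1%:R^-1 *: bsum N.+1 x|).
  by rewrite normrZ ger0_norm// mulrC ler_pdivlMl.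
have := ler_distD (N.+1%:R^-1 *: bsum N.+1 x) (mean mu tau) 0.
rewrite !subr0 distrC => H2.
have : `|mean mu tau| <= m + `|N.+1%:R^-1 *: bsum N.+1 x|.
  by rewrite (le_trans H2)// lerD2r ltW.
by rewrite {1}[`|mean mu tau|]splitr lerD2l.
Qed.

(** Serves all three cases. The decay of [G] is asked at the times [bsum N x] off the deviation set,
    already expressed in [N], so that the three inputs share one rate [psi]. *)
Lemma skew_mixing_with_rate (rf rG : nat) (D : set nat) (psi : nat -> R)
    (Cf CG Cd : R) :
  0 <= Cf -> 0 <= CG ->
  (forall N, D N -> 0 <= psi N) ->
  (forall N, D N -> forall B1 B2, Cr rf B1 -> Cr rf B2 ->
    `|corr mu (iter N f) B1 B2| <=
    Cf * psi N * Cr_norm rf B1 * Cr_norm rf B2) ->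
  (forall N, D N -> forall x, ~ dev N x -> forall B1 B2, Cr rG B1 -> Cr rG B2 ->
    `|corr nu (G (bsum N x)) B1 B2| <=
    CG * psi N * Cr_norm rG B1 * Cr_norm rG B2) ->
  (forall N, D N -> (mu (dev N) <= (Cd * psi N)%:E)%E) ->
  mixing_with_rate (mu \x nu)%E (Cr (M := XY) (maxn rf rG))
    (Cr_norm (M := XY) (maxn rf rG)) (fun n => iter n F) D psi.
Proof.
move=> Cf0 CG0 psi0 Hf HG Hd; set r := maxn rf rG; exists (CG + 2 * Cd + Cf).
move=> A B CA CB N DN.
set a := Cr_norm (M := XY) r A; set b := Cr_norm (M := XY) r B.
have a0 : 0 <= a := Cr_norm_ge0 CA.
have b0 : 0 <= b := Cr_norm_ge0 CB.
have p0 := psi0 N DN.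
have mdev := measurable_deviation_set mu f_cont tau_cont N m.
have K0 : 0 <= CG * psi N * a * b by rewrite !mulr_ge0.
have Aa (xy : X * Y) : `|A xy| <= a := normr_le_Cr_norm (M := XY) xy CA.
have Bb (xy : X * Y) : `|B xy| <= b := normr_le_Cr_norm (M := XY) xy CB.
have/(_ N) := corr_skew_product mu (nu := nu) f_cont tau_cont G_flow
  (Cr_continuous CA) (Cr_continuous CB) Aa Bb mdev K0.
move=> H; apply: le_trans (H _) _.
  move=> x xd.
  have CAx := Cr_le (leq_maxr rf rG) (Cr_section2 x CA).
  have CBx := Cr_le (leq_maxr rf rG) (Cr_section2 (iter N f x) CB).
  apply: (le_trans (HG N DN x xd _ _ CAx CBx)).
  have nA : Cr_norm rG (fun y => A (x, y)) <= a.
    apply: le_trans (Cr_norm_section2 x CA).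
    exact: Cr_norm_mono (leq_maxr rf rG) (Cr_section2 x CA).
  have nB : Cr_norm rG (fun y => B (iter N f x, y)) <= b.
    apply: le_trans (Cr_norm_section2 (iter N f x) CB).
    exact: Cr_norm_mono (leq_maxr rf rG) (Cr_section2 (iter N f x) CB).
  rewrite ler_pM ?mulr_ge0 ?(Cr_norm_ge0 CAx) ?(Cr_norm_ge0 CBx)//.
  by rewrite ler_wpM2l ?mulr_ge0.
have avA := Cr_fiber_average nu CA; have avB := Cr_fiber_average nu CB.
have CfA := Cr_le (leq_maxl rf rG) avA; have CfB := Cr_le (leq_maxl rf rG) avB.
have nA : Cr_norm rf (fun x : X => \int[nu]_y A (x, y)) <= a.
  apply: le_trans (Cr_norm_fiber_average nu CA).
  exact: Cr_norm_mono (leq_maxl rf rG) avA.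
have nB : Cr_norm rf (fun x : X => \int[nu]_y B (x, y)) <= b.
  apply: le_trans (Cr_norm_fiber_average nu CB).
  exact: Cr_norm_mono (leq_maxl rf rG) avB.
have Hf' : `|corr mu (iter N f) (fun x : X => \int[nu]_y A (x, y))
    (fun x : X => \int[nu]_y B (x, y))| <= Cf * psi N * a * b.
  apply: (le_trans (Hf N DN _ _ CfA CfB)).
  rewrite ler_pM ?mulr_ge0 ?(Cr_norm_ge0 CfA) ?(Cr_norm_ge0 CfB)//.
  by rewrite ler_wpM2l ?mulr_ge0.
have Hd' : fine (mu (dev N)) <= Cd * psi N.
  rewrite -lee_fin fineK; first exact: Hd.
  rewrite ge0_fin_numE; last exact: measure_ge0.
  by apply: le_lt_trans (probability_le1 mu mdev) _; rewrite ltry.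
rewrite (_ : (_ + _ + Cf) * _ * a * b = CG * psi N * a * b +
  2 * a * b * (Cd * psi N) + Cf * psi N * a * b); last by ring.
by do 2 apply: lerD => //; rewrite ler_wpM2l ?mulr_ge0.
Qed.

End skew_product_mixing.

(** The constant of a mixing bound carries no sign. Its absolute value works too where [psi] is
    nonnegative, and then [psi] can be replaced by a larger rate. *)
Lemma mixing_with_rate_ge0 (R : realType) (M : compactManifold R)
    (mu : probability (borel M) R) (r : nat) (I : Type) (phi : I -> M -> M)
    (D : set I) (psi : I -> R) : (forall t, D t -> 0 <= psi t) ->
  mixing_with_rate mu (Cr (M := M) r) (Cr_norm (M := M) r) phi D psi ->
  exists2 C : R, 0 <= C & forall B1 B2 : M -> R, Cr r B1 -> Cr r B2 ->
    forall t, D t ->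
    `|corr mu (phi t) B1 B2| <= C * psi t * Cr_norm r B1 * Cr_norm r B2.
Proof.
move=> psi0 [C HC]; exists `|C| => // B1 B2 CB1 CB2 t Dt.
apply: (le_trans (HC _ _ CB1 CB2 t Dt)).
rewrite !ler_wpM2r ?(Cr_norm_ge0 CB1) ?(Cr_norm_ge0 CB2) ?psi0//.
exact: ler_norm.
Qed.

(** * Rates and constants in the three cases *)

Unset Implicit Arguments.
Set Strict Implicit.

Theorem theorem4p1 (R : realType) (d : nat) (X Y : compactManifold R)
    (mu : probability (borel X) R) (nu : probability (borel Y) R)
    (f : X -> X) (G : 'rV[R]_d -> Y -> Y) (tau : X -> 'rV[R]_d)
    (f_smooth : smooth_map (cm_atlas X) (cm_atlas X) f)
    (f_mu : preserves mu f)
    (G_flow : smooth_flow G)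
    (G_nu : forall t, preserves nu (G t))
    (tau_smooth : smooth_map (cm_atlas X) (euclidean_atlas R d) tau)
    (mean_tau : mean mu tau <> 0) :
  let zeta := (mu \x nu)%E in
  let F := skew_product f G tau in
  let XY := prod_manifold X Y in
  [/\ exp_large_deviations mu f tau ->
      map_exp_mixing mu (Cr (M := X)) (Cr_norm (M := X)) f ->
      flow_exp_mixing nu (Cr (M := Y)) (Cr_norm (M := Y)) G ->
      map_exp_mixing zeta (Cr (M := XY)) (Cr_norm (M := XY)) F,
      poly_large_deviations mu f tau ->
      map_poly_mixing mu (Cr (M := X)) (Cr_norm (M := X)) f ->
      flow_poly_mixing nu (Cr (M := Y)) (Cr_norm (M := Y)) G ->
      map_poly_mixing zeta (Cr (M := XY)) (Cr_norm (M := XY)) F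
    & superpoly_large_deviations mu f tau ->
      map_rapid_mixing mu (Cr (M := X)) (Cr_norm (M := X)) f ->
      flow_rapid_mixing nu (Cr (M := Y)) (Cr_norm (M := Y)) G ->
      map_rapid_mixing zeta (Cr (M := XY)) (Cr_norm (M := XY)) F].
Proof.
move=> zeta F XY.
have f_cont : continuous f := f_smooth.1.
have tau_cont : continuous tau := tau_smooth.1.
pose m := `|mean mu tau| / 2.
have m0 : 0 < m := half_mean_gt0 mean_tau.
split.
- move=> /(_ m m0)[Cd [dd [dd0 Hd]]] [rf [df [rf0 df0 Hf]]].
  move=> [rG [dG [rG0 dG0 HG]]].
  have [Cf Cf0 {}Hf] := mixing_with_rate_ge0 (fun t _ => expR_ge0 _) Hf.
  have [CG CG0 {}HG] := mixing_with_rate_ge0 (fun t _ => expR_ge0 _) HG.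
  (* The factor [m] appears because the time in the fiber has norm at least [m * N] off the
     deviation set. *)
  pose de := Num.min df (Num.min (dG * m) dd).
  have de0 : 0 < de by rewrite !lt_min df0 dd0 mulr_gt0.
  exists (maxn rf rG), de; split => //; first by rewrite leq_max rf0.
  have ex (del x y : R) : de * x <= del * y ->
      expR (- del * y) <= expR (- de * x).
    by move=> h; rewrite ler_expR !mulNr lerN2.
  (* The summand 1 in [Cd] pays for [N = 0], which the deviation bound leaves out and where [psi] is
     1. *)
  apply: (skew_mixing_with_rate f_cont tau_cont G_flow (CG := CG) (Cf := Cf)
    (psi := fun N => expR (- de * N%:R))
    (Cd := `|Cd| + 1)) => //.
  + move=> N _ B1 B2 CB1 CB2; apply: (le_trans (Hf _ _ CB1 CB2 N I)).
    rewrite !ler_wpM2r ?(Cr_norm_ge0 CB1) ?(Cr_norm_ge0 CB2)// ler_wpM2l//.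
    by apply: ex; rewrite ler_wpM2r// ge_min lexx.
  + move=> N _ x xd B1 B2 CB1 CB2; apply: (le_trans (HG _ _ CB1 CB2 _ I)).
    rewrite !ler_wpM2r ?(Cr_norm_ge0 CB1) ?(Cr_norm_ge0 CB2)// ler_wpM2l//.
    apply: ex; apply: (@le_trans _ _ (dG * (m * N%:R))).
      by rewrite mulrA ler_wpM2r// !ge_min lexx orbT.
    by rewrite ler_wpM2l ?(ltW dG0)//; exact: birkhoff_sum_large xd.
  (* At N = 0 the deviation set is all of X, of measure 1. *)
  + move=> [|N] _.
      rewrite mulr0 expR0 mulr1.
      apply: (le_trans (probability_le1 mu _)); last by rewrite lee_fin lerDr.
      exact: measurable_deviation_set.
    apply: (le_trans (Hd N.+1 isT)); rewrite lee_fin.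
    apply: (@le_trans _ _ ((`|Cd| + 1) * expR (- dd * N.+1%:R))).
      by rewrite ler_wpM2r ?expR_ge0// (le_trans (ler_norm _))// lerDl.
    rewrite ler_wpM2l//.
    by apply: ex; rewrite ler_wpM2r// !ge_min lexx !orbT.
- move=> /(_ m m0)[Cd [dd [dd0 Hd]]] [rf [df [rf0 df0 Hf]]].
  move=> [rG [dG [rG0 dG0 HG]]].
  have [Cf Cf0 {}Hf] := mixing_with_rate_ge0 (fun t _ => powR_ge0 _ _) Hf.
  have [CG CG0 {}HG] := mixing_with_rate_ge0 (fun t _ => powR_ge0 _ _) HG.
  (* Here [m] stays out of the exponent: a power of [m * N] splits, and the power of [m] joins the
     constant for [G]. *)
  pose de := Num.min df (Num.min dG dd).
  have de0 : 0 < de by rewrite !lt_min df0 dd0 dG0.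
  exists (maxn rf rG), de; split => //; first by rewrite leq_max rf0.
  (* For [N >= 1] the base is at least 1, so lowering the exponent of decay weakens the bound. *)
  have pw (del : R) N : (0 < N)%N -> de <= del ->
      N%:R `^ (- del) <= N%:R `^ (- de) :> R.
    by move=> N0 h; rewrite ler_powR ?ler1n// lerN2.
  apply: (skew_mixing_with_rate f_cont tau_cont G_flow
    (psi := fun N => N%:R `^ (- de)) (CG := CG * m `^ (- dG)) (Cf := Cf)
    (Cd := `|Cd|)) => //.
  + by rewrite mulr_ge0// powR_ge0.
  + move=> N /= N0 B1 B2 CB1 CB2; apply: (le_trans (Hf _ _ CB1 CB2 N N0)).
    rewrite !ler_wpM2r ?(Cr_norm_ge0 CB1) ?(Cr_norm_ge0 CB2)// ler_wpM2l//.
    by apply: pw; rewrite ?ge_min ?lexx// -(ltr0n R).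
  + move=> N /= N0 x xd B1 B2 CB1 CB2.
    (* The rate of [G] is stated for nonzero times; off the deviation set [bsum N x] has positive
       norm when [N > 0]. *)
    have lg := birkhoff_sum_large xd.
    have mN0 : 0 < m * N%:R by rewrite mulr_gt0.
    apply: (le_trans (HG _ _ CB1 CB2 _ (lt_le_trans mN0 lg))).
    rewrite !ler_wpM2r ?(Cr_norm_ge0 CB1) ?(Cr_norm_ge0 CB2)//.
    rewrite -mulrA ler_wpM2l//.
    apply: (@le_trans _ _ ((m * N%:R) `^ (- dG))).
      rewrite !powRN lef_pV2 ?posrE ?powR_gt0//; last exact: lt_le_trans lg.
      by rewrite ge0_ler_powR ?nnegrE// ltW.
    rewrite powRM ?ler_wpM2l ?powR_ge0 ?(ltW m0)//.
    by apply: pw; rewrite ?ge_min ?lexx ?orbT// -(ltr0n R).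
  + move=> N /= N0; rewrite ltr0n in N0; apply: (le_trans (Hd N N0)).
    rewrite lee_fin (le_trans (ler_wpM2r _ (ler_norm Cd))) ?powR_ge0//.
    by rewrite ler_wpM2l//; apply: pw; rewrite // !ge_min lexx !orbT.
- move=> Hd Hf HG q; have [rf [rf0 {}Hf]] := Hf q; have [rG [rG0 {}HG]] := HG q.
  (* The deviation exponent has to be positive while [q] may be 0, hence [q.+1]. *)
  have q0 : 0 < q.+1%:R :> R by rewrite ltr0n.
  have [Cd {}Hd] := Hd q.+1%:R m q0 m0.
  have len0 (x : R) : 0 < x -> 0 <= x ^- q.
    by move=> x0; rewrite invr_ge0 exprn_ge0// ltW.
  have [Cf Cf0 {}Hf] := mixing_with_rate_ge0 (fun t => len0 _) Hf.
  have [CG CG0 {}HG] := mixing_with_rate_ge0 (fun t => len0 _) HG.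
  exists (maxn rf rG); split; first by rewrite leq_max rf0.
  (* The factor [m ^- q] converts decay in the norm of the time into decay in [N]. *)
  apply: (skew_mixing_with_rate f_cont tau_cont G_flow
    (psi := fun N => N%:R ^- q) (CG := CG * m ^- q) (Cf := Cf) (Cd := `|Cd|)) => //.
  + by rewrite mulr_ge0// len0.
  + by move=> N N0 B1 B2 CB1 CB2; exact: Hf.
  + move=> N /= N0 x xd B1 B2 CB1 CB2.
    have lg := birkhoff_sum_large xd.
    have mN0 : 0 < m * N%:R by rewrite mulr_gt0.
    apply: (le_trans (HG _ _ CB1 CB2 _ (lt_le_trans mN0 lg))).
    rewrite !ler_wpM2r ?(Cr_norm_ge0 CB1) ?(Cr_norm_ge0 CB2)//.
    rewrite -mulrA ler_wpM2l//.
    rewrite -invfM -exprMn lef_pV2 ?posrE ?exprn_gt0//.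
      by rewrite lerXn2r ?nnegrE// ltW.
    exact: lt_le_trans lg.
  + move=> N /= N0; rewrite ltr0n in N0; apply: (le_trans (Hd N N0)).
    rewrite lee_fin (le_trans (ler_wpM2r _ (ler_norm Cd))) ?powR_ge0//.
    rewrite ler_wpM2l// -powR_mulrn// -powRN ler_powR ?ler1n//.
    by rewrite lerN2 ler_nat.
Qed.
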